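(* Let $X$ be a locally convex space and let $(T(t))_{t\geqslant0}$ be a $C_0$-semigroup on $X$. Consider the following statements. (i) $(T(t))_{t\geqslant0}$ is uniformly exponentially stable. (ii) $\exists\,\omega>0\ \forall\, q\in\Gamma_X\ \exists\, p\in\Gamma_X$: $\lim_{t\to\infty}\sup_{p(x)\leqslant1}q(e^{\omega t}T(t)x)=0$. (iii) $\exists\,\omega>0\ \forall\, x\in X$: $\lim_{t\to\infty}e^{\omega t}T(t)x=0$. (iv) $(T(t))_{t\geqslant0}$ is strongly exponentially stable. (v) $\forall\, B\in\mathcal{B}_X\ \exists\,\omega>0\ \forall\, q\in\Gamma_X$: $\lim_{t\to\infty}q_B(e^{\omega t}T(t))=0$. If $X$ is barrelled, then (i)--(iii) are equivalent. If $X$ is Mackey complete, then (iv) and (v) are equivalent. If $X$ is a Baire space, then all statements (i)--(v) are equivalent.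
   Context: Locally convex spaces are assumed Hausdorff. For a locally convex space $X$, $\Gamma_X$ denotes a fundamental system of continuous seminorms determining the topology of $X$ (every element of $\Gamma_X$ is a continuous seminorm, and for each continuous seminorm $p$ on $X$ there are $q\in\Gamma_X$ and $C\geqslant0$ with $p\leqslant Cq$), $L(X)$ is the space of all continuous linear operators $X\to X$, and $\mathcal{B}_X$ is the collection of all bounded subsets of $X$. For $q\in\Gamma_X$, $B\in\mathcal{B}_X$ and $S\in L(X)$ put $q_B(S)=\sup_{x\in B}q(Sx)$. $X$ is barrelled if every absolutely convex, absorbing and closed set is a neighborhood of zero. A sequence $(x_n)_{n\in\mathbb{N}}$ in $X$ is Mackey Cauchy if there exist $B\in\mathcal{B}_X$ and scalars $b_{n,k}$ tending to zero as $n$ and $k$ both tend to infinity such that $x_n-x_k\in b_{n,k}B$ for all $n,k\in\mathbb{N}$; $X$ is Mackey complete if every Mackey Cauchy sequence in $X$ converges. $X$ is a Baire space if $X$ cannot be written as a countable union of nowhere dense sets. A $C_0$-semigroup on $X$ is a family $(T(t))_{t\geqslant0}\subseteq L(X)$ with $T(0)=\mathrm{id}_X$, $T(s+t)=T(s)T(t)$ for all $s,t\geqslant0$, and $\lim_{t\to t_0}T(t)x=T(t_0)x$ for all $t_0\geqslant0$, $x\in X$. It is uniformly exponentially stable if $\exists\omega>0\ \forall B\in\mathcal{B}_X, q\in\Gamma_X$: $\lim_{t\to\infty}q_B(e^{\omega t}T(t))=0$, and strongly exponentially stable if $\forall x\in X\ \exists\omega>0$: $\lim_{t\to\infty}e^{\omega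 t}T(t)x=0$. *)

(* Defs.v *)
From HB Require Import structures.
From mathcomp Require Import all_boot all_order all_algebra.
From mathcomp Require Import complex.
From mathcomp Require Import all_classical all_reals all_analysis.

Set Implicit Arguments.
Unset Strict Implicit.
Unset Printing Implicit Defensive.

Import Order.TTheory GRing.Theory Num.Theory.
Import numFieldNormedType.Exports.

Local Open Scope classical_set_scope.
Local Open Scope ring_scope.

(* A locally convex space is a [tvsType (scalar_field R k)] that is Hausdorff
   (the latter is not part of [tvsType]); [k] selects real or complex scalars. *)
Variant scalar_kind := RealScalars | ComplexScalars.

Definition scalar_field (R : realType) (k : scalar_kind) : numFieldType :=
  match k with RealScalars => R | ComplexScalars => R[i] end.

Definition of_real (R : realType) (k : scalar_kind) : R -> scalar_field R k :=
  match k with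
  | RealScalars => fun r => r
  | ComplexScalars => fun r => real_complex R r
  end.

Section topological_vector_spaces.
Context {K : numFieldType} {X : tvsType K}.

(* When K is complex, the order of K is partial and [0 < r] entails r real. *)
Definition absorbs (A B : set X) :=
  exists2 r : K, 0 < r & forall a : K, r <= `|a| -> B `<=` *:%R a @` A.

Definition absorbing (A : set X) := forall x, absorbs A [set x].

(* von Neumann boundedness; [bounded_set] of the library is tied to a norm. *)
Definition vN_bounded (B : set X) := forall U : set X, nbhs 0 U -> absorbs U B.

Definition balanced (A : set X) :=
  forall a : K, `|a| <= 1 -> *:%R a @` A `<=` A.

Definition absolutely_convex (A : set X) := convex_set A /\ balanced A.

Definition continuous_linear (S : X -> X) := linear S /\ continuous S.

End topological_vector_spaces.

Definition barrelled (K : numFieldType) (X : tvsType K) :=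
  forall A : set X, absolutely_convex A -> absorbing A -> closed A -> nbhs 0 A.

Definition mackey_cauchy (K : numFieldType) (X : tvsType K) (x : nat -> X) :=
  exists B : set X, vN_bounded B /\
  exists b : nat -> nat -> K,
    b nk.1 nk.2 @[nk --> filter_prod \oo \oo] --> (0 : K^o) /\
    forall n k, exists2 y, B y & x n - x k = b n k *: y.

Definition mackey_complete (K : numFieldType) (X : tvsType K) :=
  forall x : nat -> X, mackey_cauchy x -> exists l : X, x @ \oo --> l.

Definition nowhere_dense (T : topologicalType) (A : set T) :=
  interior (closure A) = set0.

Definition baire_space (T : topologicalType) :=
  ~ exists F : nat -> set T,
      (forall n, nowhere_dense (F n)) /\ \bigcup_n F n = [set: T].

Section semigroups.
Context {R : realType} {k : scalar_kind} {X : tvsType (scalar_field R k)}.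

(* Homogeneity is p (a *: x) = |a| * p x, stated in the scalar_field field because
   [`|a|] has type [scalar_field R k] rather than R. *)
Definition seminorm (p : X -> R) :=
  [/\ forall x, 0 <= p x,
      forall x y, p (x + y) <= p x + p y &
      forall (a : scalar_field R k) x, of_real k (p (a *: x)) = `|a| * of_real k (p x)].

Definition continuous_seminorm (p : X -> R) := seminorm p /\ continuous p.

Definition fundamental_system (Gamma : set (X -> R)) :=
  (forall p, Gamma p -> continuous_seminorm p) /\
  (forall p, continuous_seminorm p ->
     exists2 q, Gamma q & exists2 C : R, 0 <= C & forall x, p x <= C * q x).

(* The supremum of q (S x) over x in A, taken in [0, +oo]; adjoining 0 only
   affects A = set0, where [ereal_sup] would otherwise be -oo.
   With B bounded, [sup_on q B S] is the seminorm q_B(S). *)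
Definition sup_on (q : X -> R) (A : set X) (S : X -> X) : \bar R :=
  ereal_sup (0%E |` [set (q (S x))%:E | x in A]).

(* Only the values T t for 0 <= t are relevant. *)
Definition C0_semigroup (T : R -> X -> X) :=
  [/\ forall t, 0 <= t -> continuous_linear (T t),
      forall x, T 0 x = x,
      forall s t x, 0 <= s -> 0 <= t -> T (s + t) x = T s (T t x) &
      forall (t0 : R) x, 0 <= t0 ->
        T t x @[t --> within [set t : R | 0 <= t] (nbhs t0)] --> T t0 x].

(* The operator e^{w t} T(t). *)
Definition rescaled (w : R) (T : R -> X -> X) (t : R) : X -> X :=
  fun x => of_real k (expR (w * t)) *: T t x.

Definition uniformly_exp_stable (Gamma : set (X -> R)) (T : R -> X -> X) :=
  exists2 w : R, 0 < w &
    forall B q, vN_bounded B -> Gamma q ->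
      sup_on q B (rescaled w T t) @[t --> +oo] --> 0%E.

Definition strongly_exp_stable (T : R -> X -> X) :=
  forall x : X, exists2 w : R, 0 < w &
    rescaled w T t x @[t --> +oo] --> (0 : X).

End semigroups.

(* Main.v *)
(* The implications (ii) => (i) => (iii) and (v) => (iv) hold in every locally
   convex space, because the seminorms in Gamma determine the topology (Minkowski
   gauges). For (iii) => (ii) in a barrelled space, the points whose orbit under
   e^{w t} T(t) stays in the closed unit ball of q form a barrel; halving w then
   turns boundedness into decay. For (iv) => (ii), resp. (v), the closed sets of
   points whose orbit under e^{t/(n+1)} T(t) has q_n at most m cover X, so one of
   them contains x + u and x - u for all u in a neighbourhood of 0 when X is Baire,
   resp. in a multiple of a given bounded set B when X is Mackey complete. Choosing
   the q_n adversarially shows that some exponent works for all q at once. *)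
Require Import Defs.
From HB Require Import structures.
From mathcomp Require Import all_boot all_order all_algebra.
From mathcomp Require Import complex.
From mathcomp Require Import all_classical all_reals all_analysis.

Set Implicit Arguments.
Unset Strict Implicit.
Unset Printing Implicit Defensive.

Import Order.TTheory GRing.Theory Num.Theory.
Import numFieldNormedType.Exports.

Local Open Scope classical_set_scope.
Local Open Scope ring_scope.

(** * Scalars: the embedded reals and a real-valued modulus *)

Section scalars.
Context {R : realType} {k : scalar_kind}.
Local Notation K := (scalar_field R k).
Local Notation "r %:K" := (@of_real R k r) (at level 2, format "r %:K").
Implicit Types (r s : R) (a b : K).

Lemma of_realD r s : (r + s)%:K = r%:K + s%:K.
Proof. by case: k => //=; rewrite rmorphD. Qed.

Lemma of_realM r s : (r * s)%:K = r%:K * s%:K.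
Proof. by case: k => //=; rewrite rmorphM. Qed.

Lemma of_real0 : 0%:K = 0.
Proof. by case: k => //=; rewrite rmorph0. Qed.

Lemma of_real1 : 1%:K = 1.
Proof. by case: k => //=; rewrite rmorph1. Qed.

Lemma of_realN r : (- r)%:K = - r%:K.
Proof. by case: k => //=; rewrite rmorphN. Qed.

Lemma of_realV r : (r^-1)%:K = r%:K^-1.
Proof. by case: k => //=; rewrite fmorphV. Qed.

Lemma of_real_inj : injective (@of_real R k).
Proof. by case: k => //=; exact: fmorph_inj. Qed.

Lemma ler_of_real r s : (r%:K <= s%:K) = (r <= s).
Proof. by case: k => //=; exact: lecR. Qed.

Lemma ltr_of_real r s : (r%:K < s%:K) = (r < s).
Proof. by case: k => //=; exact: ltcR. Qed.

Lemma modulus_subproof a : exists r, r%:K = `|a|.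
Proof.
case: k a => /= a; first by exists `|a|.
by exists (complex.Re `|a|); rewrite normc_def.
Qed.

(** The norm of a complex scalar is itself a complex number; taking its real preimage allows
    products and comparisons with values of seminorms. *)
Definition modulus a : R := projT1 (cid (modulus_subproof a)).

Lemma modulusE a : (modulus a)%:K = `|a|.
Proof. by rewrite /modulus; case: cid. Qed.

Lemma modulus_ge0 a : 0 <= modulus a.
Proof. by rewrite -ler_of_real modulusE of_real0. Qed.

Lemma modulusM a b : modulus (a * b) = modulus a * modulus b.
Proof. by apply: of_real_inj; rewrite of_realM !modulusE normrM. Qed.

Lemma modulus_gt0 a : (0 < modulus a) = (a != 0).
Proof. by rewrite -ltr_of_real modulusE of_real0 normr_gt0. Qed.

Lemma modulus_of_real r : 0 <= r -> modulus r%:K = r.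
Proof.
by move=> r0; apply: of_real_inj; rewrite modulusE ger0_norm// -of_real0 ler_of_real.
Qed.

Lemma modulusN1 : modulus (-1) = 1.
Proof. by apply: of_real_inj; rewrite modulusE normrN1 of_real1. Qed.

Lemma of_real_gt0P a : 0 < a -> exists2 r, 0 < r & a = r%:K.
Proof.
by move=> a0; exists (modulus a); rewrite ?modulus_gt0 ?gt_eqF// modulusE gtr0_norm.
Qed.

End scalars.

(** * Seminorms and neighbourhoods of 0 *)

Section seminorms.
Context {R : realType} {k : scalar_kind} {X : tvsType (scalar_field R k)}.
Local Notation K := (scalar_field R k).
Local Notation "r %:K" := (@of_real R k r) (at level 2, format "r %:K").
Implicit Types (r s : R) (a b : K) (p q : X -> R) (U V : set X) (x y : X).

Lemma seminormZ p a x : seminorm p -> p (a *: x) = modulus a * p x.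
Proof.
by move=> [_ _ hp]; apply: (@of_real_inj R k); rewrite hp of_realM modulusE.
Qed.

Lemma seminormZr p r x : seminorm p -> 0 <= r -> p (r%:K *: x) = r * p x.
Proof. by move=> sp r0; rewrite seminormZ// modulus_of_real. Qed.

Lemma seminorm0 p : seminorm p -> p 0 = 0.
Proof.
by move=> sp; rewrite -(scale0r 0) -of_real0 seminormZr// mul0r.
Qed.

Lemma seminormN p x : seminorm p -> p (- x) = p x.
Proof. by move=> sp; rewrite -scaleN1r seminormZ// modulusN1 mul1r. Qed.

Lemma seminormB p x y : seminorm p -> p (x - y) <= p x + p y.
Proof. by move=> sp; rewrite -(seminormN y sp); case: sp. Qed.

Lemma seminorm_dist p x y : seminorm p -> `|p x - p y| <= p (x - y).
Proof.
move=> sp; have le_sub u v : p u <= p (u - v) + p v.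
  by rewrite -{1}(subrK v u); case: sp.
rewrite ler_norml lerBlDr le_sub andbT lerNl opprB lerBlDr.
by rewrite -(seminormN (x - y) sp) opprB le_sub.
Qed.

(** For [a != 0] the missing inequality is the assumed one for [a^-1] at the point [a *: x]; for
    [a = 0] it is nonnegativity. *)
Lemma le_seminorm p :
  (forall x, 0 <= p x) -> (forall x y, p (x + y) <= p x + p y) ->
  (forall a x, p (a *: x) <= modulus a * p x) -> seminorm p.
Proof.
move=> p0 pD pZ; split=> // a x; rewrite -modulusE -of_realM.
congr of_real; apply/eqP; rewrite eq_le pZ/=.
have [->|a0] := eqVneq (modulus a) 0; first by rewrite mul0r.
have a_neq0 : a != 0 by rewrite -modulus_gt0 lt_def a0 modulus_ge0.
rewrite -{1}(scale1r x) -(mulVf a_neq0) -scalerA.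
have := pZ a^-1 (a *: x); rewrite -(ler_pM2l (x := modulus a)) ?modulus_gt0//.
move=> /le_trans; apply.
by rewrite mulrA -modulusM divff// -of_real1 modulus_of_real// mul1r.
Qed.

Lemma nbhs0_seminorm_lt p r : continuous_seminorm p -> 0 < r ->
  nbhs (0 : X) [set x | p x < r].
Proof.
move=> [sp cp] r0; have := cp 0; rewrite /continuous_at seminorm0//.
by move=> /cvgr_lt; apply.
Qed.

(** Continuity of scaling at [(0, x)]. For general [x] it makes neighbourhoods of 0 absorbing; for
    [x = 0] it makes their balanced cores neighbourhoods of 0. *)
Lemma scale_nbhs0 x U : nbhs 0 U -> exists2 r, 0 < r &
  exists2 V, nbhs x V & forall a y, modulus a < r -> V y -> U (a *: y).
Proof.
move=> U0; have := @scale_continuous K X (0, x).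
rewrite /continuous_at /= scale0r => /(_ U U0)[[A V] [/= A0 Vx] AV].
have [e /= e0 eA] := A0.
have [r r0 er] := of_real_gt0P e0.
exists r => //; exists V => // a y ar Vy; apply: (AV (a, y)); split => //=.
by apply: eA; rewrite /= sub0r normrN -modulusE er ltr_of_real.
Qed.

Lemma nbhs_translate x U : nbhs 0 U -> nbhs x [set y | U (y - x)].
Proof.
move=> /(nbhsT x); apply: filterS => y /= [u Uu <-].
by rewrite (addrC x) addrK.
Qed.

Lemma nbhs0_translate x U : nbhs x U -> nbhs 0 [set y | U (x + y)].
Proof.
move=> /(nbhsB (- x)); rewrite addNr; apply: filterS => y /= [u Uu <-].
by rewrite addrA subrr add0r.
Qed.

Lemma nbhs0_scale a U : a != 0 -> nbhs 0 U -> nbhs 0 [set x | U (a^-1 *: x)].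
Proof.
move=> a0 /(nbhs0Z a0); apply: filterS => x /= [u Uu <-].
by rewrite scalerA mulVf// scale1r.
Qed.

(** The reverse triangle inequality reduces continuity at [x] to 0, where the ball of radius [e] is
    the unit ball scaled by [e]. *)
Lemma nbhs0_seminorm_continuous p : seminorm p ->
  nbhs (0 : X) [set x | p x <= 1] -> continuous p.
Proof.
move=> sp p1 x; apply/cvgrPdist_le => e e0.
have eK0 : e%:K != 0 by rewrite -modulus_gt0 modulus_of_real// ltW.
have := nbhs_translate x (nbhs0_scale eK0 p1).
apply: filterS => y /=; rewrite -of_realV seminormZr ?invr_ge0 ?(ltW e0)//.
rewrite ler_pdivrMl// mulr1; apply: le_trans.
by rewrite distrC; exact: seminorm_dist.
Qed.

Lemma nbhs0_absolutely_convex U : nbhs (0 : X) U ->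
  exists V, [/\ nbhs 0 V, V `<=` U,
    forall a x, modulus a <= 1 -> V x -> V (a *: x) &
    forall r s x y, 0 <= r -> 0 <= s -> r + s = 1 -> V x -> V y ->
      V (r%:K *: x + s%:K *: y)].
Proof.
move=> U0; have [B Bconvex [Bopen /(_ 0 U U0)[W [BW W0] WU]]] :=
  @locally_convex K X.
have Wnbhs : nbhs 0 W by apply: open_nbhs_nbhs; split => //; exact: Bopen.
have Wconvex r s x y : 0 <= r -> 0 <= s -> r + s = 1 -> W x -> W y ->
    W (r%:K *: x + s%:K *: y).
  move=> r0 s0 rs Wx Wy.
  have r01 : 0 <= r%:K <= 1.
    by rewrite -(of_real0 (R := R)) -of_real1 !ler_of_real r0 -rs lerDl.
  have := Bconvex W (mem_set BW) x y (Itv01 (andP r01).1 (andP r01).2).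
  rewrite !inE => /(_ Wx Wy); rewrite /conv/=.
  suff -> : s%:K = 1 - r%:K by [].
  by rewrite -of_real1 -of_realN -of_realD -rs addrAC subrr add0r.
(* The balanced core of the convex neighbourhood [W]; it inherits convexity. *)
exists [set x | forall a, modulus a <= 1 -> W (a *: x)]; split.
- have [r r0 [V V0 rV]] := scale_nbhs0 0 Wnbhs.
  have h0 : (r / 2)%:K != 0.
    by rewrite -modulus_gt0 modulus_of_real ?divr_gt0// ?divr_ge0// ltW.
  apply: filterS (nbhs0_scale h0 V0) => x /= Vx a a1.
  have -> : a *: x = (a * (r / 2)%:K) *: ((r / 2)%:K^-1 *: x).
    by rewrite scalerA mulfK.
  apply: rV => //; rewrite modulusM modulus_of_real ?divr_ge0 ?(ltW r0)//.
  rewrite (@le_lt_trans _ _ (r / 2))// ?ler_piMl ?divr_ge0 ?(ltW r0)//.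
  by rewrite gtr_pMr// invf_lt1// ltr1n.
- by move=> x /(_ 1); rewrite scale1r -of_real1 modulus_of_real// => /(_ (lexx _))/WU.
- move=> a x a1 Wx b b1; rewrite scalerA; apply: Wx.
  by rewrite modulusM mulr_ile1// modulus_ge0.
- move=> r s x y r0 s0 rs Wx Wy a a1.
  rewrite scalerDr !(scalerA a) ![a * _]mulrC -!scalerA.
  by apply: Wconvex => //; [exact: Wx|exact: Wy].
Qed.

Lemma absolutely_convex_seminorm_le (I : Type) (D : set I) (p : I -> X -> R) r :
  (forall i, D i -> seminorm (p i)) ->
  absolutely_convex [set x | forall i, D i -> p i x <= r].
Proof.
move=> sp; split=> [x y l|a a1 _ [x px <-] i Di]; last first.
  have [p0 _ _] := sp i Di; rewrite seminormZ; last exact: sp.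
  apply: le_trans (px i Di); rewrite ler_piMl ?p0//.
  by rewrite -(ler_of_real (k := k)) modulusE of_real1.
rewrite !inE => px py i Di; have [_ pD _] := sp i Di.
have a0 : 0 <= l%:num by rewrite ge0.
have a1 : l%:num <= 1 by rewrite le1.
rewrite /conv/=; set a := l%:num; set b := unstable.onem a.
have ab1 : modulus a + modulus b = 1.
  apply: (@of_real_inj R k); rewrite of_realD of_real1 !modulusE.
  have b0 : 0 <= b by rewrite subr_ge0.
  by rewrite !ger0_norm// addrC subrK.
rewrite (le_trans (pD _ _))// !(seminormZ _ _ (sp i Di)).
rewrite -[leRHS]mul1r -ab1 mulrDl lerD// ler_wpM2l ?modulus_ge0//; first exact: px.
exact: py.
Qed.

End seminorms.

(** * The Minkowski gauge of an absolutely convex neighbourhood of 0 *)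

Section minkowski_gauge.
Context {R : realType} {k : scalar_kind} {X : tvsType (scalar_field R k)}.
Local Notation "r %:K" := (@of_real R k r) (at level 2, format "r %:K").
Implicit Types (r s : R) (a b : scalar_field R k) (x y : X).

Definition dilations (V : set X) (x : X) : set R :=
  [set r | 0 < r /\ V (r^-1%:K *: x)].

Definition gauge (V : set X) (x : X) : R := inf (dilations V x).

Context (V : set X) (V0 : nbhs 0 V)
  (Vbalanced : forall a x, modulus a <= 1 -> V x -> V (a *: x))
  (Vconvex : forall r s x y,
    0 <= r -> 0 <= s -> r + s = 1 -> V x -> V y -> V (r%:K *: x + s%:K *: y)).

Lemma dilations_neq0 x : dilations V x !=set0.
Proof.
have [r r0 [W /nbhs_singleton Wx rW]] := scale_nbhs0 x V0.
(* The inverse [r / 2] is strictly below the threshold [r]. *)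
exists (2 / r); split; first by rewrite divr_gt0.
rewrite invf_div; apply: rW => //.
rewrite modulus_of_real ?divr_ge0 ?(ltW r0)//.
by rewrite gtr_pMr// invf_lt1// ltr1n.
Qed.

Lemma dilations_lb0 x : lbound (dilations V x) 0.
Proof. by move=> r [/ltW]. Qed.

Lemma gauge_ge0 x : 0 <= gauge V x.
Proof. exact: lb_le_inf (dilations_neq0 x) (@dilations_lb0 x). Qed.

Lemma gauge_le x r : dilations V x r -> gauge V x <= r.
Proof. by apply: ge_inf; exists 0; exact: dilations_lb0. Qed.

Lemma gauge_ltP x r : gauge V x < r -> exists2 s, dilations V x s & s < r.
Proof. by move/inf_lt; apply; exact: dilations_neq0. Qed.

Lemma gauge_lt1 x : gauge V x < 1 -> V x.
Proof.
move=> /gauge_ltP[s [s0 Vs] s1].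
have -> : x = s%:K *: (s^-1%:K *: x).
  by rewrite scalerA -of_realM divff ?gt_eqF// of_real1 scale1r.
by apply: Vbalanced => //; rewrite modulus_of_real ltW.
Qed.

Lemma gaugeD x y : gauge V (x + y) <= gauge V x + gauge V y.
Proof.
apply/ler_addgt0Pr => e e0.
have e20 : 0 < e / 2 by rewrite divr_gt0.
have [r [r0 Vr] rx] := @gauge_ltP x (gauge V x + e / 2) (ltr_pwDr e20 (lexx _)).
have [s [s0 Vs] sy] := @gauge_ltP y (gauge V y + e / 2) (ltr_pwDr e20 (lexx _)).
have rs0 : 0 < r + s by rewrite addr_gt0.
apply: (@le_trans _ _ (r + s)).
  apply: gauge_le; split => //.
  (* The rescaled sum is the convex combination of [x / r] and [y / s] with weights [r / (r + s)]
     and [s / (r + s)]. *)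
  have -> : (r + s)^-1%:K *: (x + y) =
      (r / (r + s))%:K *: (r^-1%:K *: x) + (s / (r + s))%:K *: (s^-1%:K *: y).
    rewrite !scalerA -!of_realM scalerDr; congr (of_real k _ *: _ + of_real k _ *: _).
      by rewrite mulrAC divff ?gt_eqF// mul1r.
    by rewrite mulrAC divff ?gt_eqF// mul1r.
  apply: Vconvex; rewrite ?divr_ge0 ?(ltW r0) ?(ltW s0) ?(ltW rs0)//.
  by rewrite -mulrDl divff ?gt_eqF.
by rewrite [e]splitr addrACA lerD// ltW.
Qed.

Lemma gaugeZ a x : gauge V (a *: x) <= modulus a * gauge V x.
Proof.
have [->|a0] := eqVneq a 0.
  have -> : modulus (0 : scalar_field R k) = 0.
    by rewrite -of_real0 modulus_of_real.
  rewrite scale0r mul0r; apply/ler_addgt0Pr => e e0; rewrite add0r.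
  by apply: gauge_le; split=> //; rewrite scaler0; exact: nbhs_singleton.
have a_gt0 : 0 < modulus a by rewrite modulus_gt0.
rewrite -ler_pdivrMl//; apply: lb_le_inf; first exact: dilations_neq0.
move=> r [r0 Vr]; rewrite ler_pdivrMl//; apply: gauge_le; split.
  by rewrite mulr_gt0.
(* The factor [a] divided by its modulus has modulus 1, so balancedness absorbs it. *)
have -> : (modulus a * r)^-1%:K *: (a *: x) =
    ((modulus a)^-1%:K * a) *: (r^-1%:K *: x).
  by rewrite !scalerA invfM of_realM mulrAC.
apply: Vbalanced => //.
by rewrite modulusM modulus_of_real ?invr_ge0 ?modulus_ge0// mulVf ?gt_eqF.
Qed.

Lemma gauge_continuous_seminorm : continuous_seminorm (gauge V).
Proof.
have sV : seminorm (gauge V).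
  apply: le_seminorm; [exact: gauge_ge0|exact: gaugeD|exact: gaugeZ].
split=> //; apply: nbhs0_seminorm_continuous => //; apply: filterS V0 => x Vx.
by apply: gauge_le; split=> //; rewrite invr1 of_real1 scale1r.
Qed.

End minkowski_gauge.

(** * Topology and boundedness in terms of a fundamental system *)

Section fundamental_systems.
Context {R : realType} {k : scalar_kind} {X : tvsType (scalar_field R k)}.
Context {Gamma : set (X -> R)} (fundamentalGamma : fundamental_system Gamma).
Local Notation "r %:K" := (@of_real R k r) (at level 2, format "r %:K").
Implicit Types (r s : R) (a b : scalar_field R k) (x y : X) (q : X -> R).

Lemma fundamental_continuous q : Gamma q -> continuous_seminorm q.
Proof. by move=> /fundamentalGamma.1. Qed.

Lemma fundamental_seminorm q : Gamma q -> seminorm q.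
Proof. by move=> /fundamental_continuous[]. Qed.

(** The gauge of an absolutely convex neighbourhood inside [U] is a continuous seminorm, hence
    dominated by a multiple of some [q] in [Gamma]. *)
Lemma fundamental_nbhs0 (U : set X) : nbhs 0 U ->
  exists2 q, Gamma q & exists2 r, 0 < r & forall x, q x < r -> U x.
Proof.
move=> /nbhs0_absolutely_convex[V [V0 VU Vbalanced Vconvex]].
have [_ /(_ _ (gauge_continuous_seminorm V0 Vbalanced Vconvex))] :=
  fundamentalGamma.
move=> [q Gq [C C0 leCq]]; exists q => //.
(* The constant [C] may be 0, so [C + 1] is inverted instead. *)
have C1 : 0 < C + 1 by rewrite ltr_wpDl.
exists (C + 1)^-1; first by rewrite invr_gt0.
move=> x qx; apply/VU/(gauge_lt1 V0 Vbalanced)/(le_lt_trans (leCq x)).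
have q0 : 0 <= q x by case: (fundamental_seminorm Gq).
apply: (@le_lt_trans _ _ ((C + 1) * q x)); first by rewrite ler_wpM2r// lerDl.
by rewrite mulrC -ltr_pdivlMr// div1r.
Qed.

Lemma fundamental_cvg0 {T : Type} {F : set_system T} {FF : Filter F}
    (f : T -> X) :
  f @ F --> (0 : X) <->
  forall q, Gamma q -> forall e, 0 < e -> \forall t \near F, q (f t) < e.
Proof.
split=> [f0 q /fundamental_continuous cq e e0|f0 U U0].
  exact: (f0 _ (nbhs0_seminorm_lt cq e0)).
have [q Gq [e e0 qU]] := fundamental_nbhs0 U0.
by apply: filterS (f0 q Gq e e0) => t /qU.
Qed.

Lemma vN_boundedP (B : set X) : vN_bounded B <->
  forall q, Gamma q -> exists M, forall x, B x -> q x <= M.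
Proof.
split=> [Bb q Gq|Bq U U0].
  have cq := fundamental_continuous Gq.
  have [a a0 /(_ a)] := Bb _ (nbhs0_seminorm_lt cq (@ltr01 R)).
  rewrite gtr0_norm// => /(_ (lexx _)) aB; exists (modulus a) => x /aB[y /= qy <-].
  by rewrite (seminormZ _ _ cq.1) ler_piMr ?modulus_ge0// ltW.
have [q Gq [e e0 qU]] := fundamental_nbhs0 U0.
have [M leM] := Bq q Gq.
(* Since [M < r * e], dividing [x] by a scalar of modulus at least [r] brings [q x] below [e]. *)
pose r := (`|M| + 1) / e.
have r0 : 0 < r by rewrite divr_gt0// ltr_wpDl.
exists (r%:K); first by rewrite -(of_real0 (k := k)) ltr_of_real.
move=> a; rewrite -modulusE ler_of_real => ra x Bx.
have ma0 : 0 < modulus a by exact: lt_le_trans ra.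
have a0 : a != 0 by rewrite -modulus_gt0.
exists (a^-1 *: x); last by rewrite scalerA divff// scale1r.
apply: qU; rewrite -(ltr_pM2l ma0) -(seminormZ _ _ (fundamental_seminorm Gq)).
rewrite scalerA divff// scale1r (le_lt_trans (leM x Bx))//.
apply: (@lt_le_trans _ _ (r * e)); last by rewrite ler_wpM2r// ltW.
by rewrite mulfVK ?gt_eqF// (le_lt_trans (ler_norm M))// ltrDl.
Qed.

Lemma vN_bounded1 x : vN_bounded [set x].
Proof. by apply/vN_boundedP => q _; exists (q x) => y ->. Qed.

End fundamental_systems.

(** * Orbits of the rescaled semigroup *)

Section semigroup_orbits.
Context {R : realType} {k : scalar_kind} {X : tvsType (scalar_field R k)}.
Context {Gamma : set (X -> R)} (fundamentalGamma : fundamental_system Gamma).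
Context {T : R -> X -> X} (semigroupT : C0_semigroup T).
Implicit Types (w t C : R) (x : X) (q : X -> R) (A : set X).

Lemma seminorm_rescaled q w t x : seminorm q ->
  q (rescaled w T t x) = expR (w * t) * q (T t x).
Proof. by move=> sq; rewrite seminormZr// expR_ge0. Qed.

Lemma rescaled_split q w w' t x : seminorm q ->
  q (rescaled w T t x) = expR ((w - w') * t) * q (rescaled w' T t x).
Proof.
by move=> sq; rewrite !seminorm_rescaled// mulrA -expRD -mulrDl subrK.
Qed.

Lemma le_seminorm_rescaled q w w' t x : seminorm q -> w <= w' -> 0 <= t ->
  q (rescaled w T t x) <= q (rescaled w' T t x).
Proof.
move=> sq ww' t0; rewrite !seminorm_rescaled// ler_wpM2r//; first by case: sq.
by rewrite ler_expR ler_wpM2r.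
Qed.

(** Turns conditions on orbits into conditions on a family of continuous seminorms, from which
    closedness and absolute convexity follow. *)
Lemma continuous_seminorm_rescaled q w t : continuous_seminorm q -> 0 <= t ->
  continuous_seminorm (fun x => q (rescaled w T t x)).
Proof.
move=> [sq cq] t0; have [/(_ t t0)[linT cT] _ _ _] := semigroupT.
have TD x y : T t (x + y) = T t x + T t y.
  by have := linT 1 x y; rewrite !scale1r.
have T0 : T t 0 = 0.
  by have := linT (-1) 0 0; rewrite scaler0 addr0 scaleN1r addNr.
have TZ a x : T t (a *: x) = a *: T t x.
  by have := linT a x 0; rewrite T0 !addr0.
split.
  split.
  - by move=> x; case: sq.
  - by move=> x y; rewrite /rescaled TD scalerDr; case: sq.
  - move=> a x; rewrite /rescaled TZ scalerA mulrC -scalerA.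
    by case: sq => _ _ ->.
suff -> : (fun x => q (rescaled w T t x)) = (fun x => expR (w * t) * q (T t x)).
  move=> x; apply: cvgM; first exact: cvg_cst.
  by apply: continuous_comp; [exact: cT|exact: cq].
by apply/funext => x; rewrite seminorm_rescaled.
Qed.

(** Convergence bounds the orbit by 1 beyond some time; up to that time, strong continuity on a
    compact interval provides a maximum. *)
Lemma bounded_orbit q w x : Gamma q ->
  rescaled w T t x @[t --> +oo] --> (0 : X) ->
  exists C, forall t, 0 <= t -> q (rescaled w T t x) <= C.
Proof.
move=> Gq /(fundamental_cvg0 fundamentalGamma)/(_ q Gq 1 ltr01)[t0 [_ t0P]].
have [sq cq] := fundamental_continuous fundamentalGamma Gq.
have [_ _ _ cT] := semigroupT.
pose M := Num.max 0 t0.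
have contf : {within `[0, M], continuous (fun t => q (rescaled w T t x))}.
  apply/subspace_continuousP => t; rewrite /= in_itv/= => /andP[t_ge0 _].
  have -> : (fun t => q (rescaled w T t x)) = (fun t => expR (w * t) * q (T t x)).
    by apply/funext => s; rewrite seminorm_rescaled.
  apply: cvgM.
    apply: cvg_within_filter; apply: continuous_comp; last exact: continuous_expR.
    by apply: cvgM; [exact: cvg_cst|exact: cvg_id].
  (* Strong continuity is known only within the half-line, which contains [[0, M]]. *)
  have sub : within `[0, M] (nbhs t) --> within [set t : R | 0 <= t] (nbhs t).
    by apply: within_subset => s /=; rewrite in_itv/= => /andP[].
  apply: (cvg_trans (cvg_app _ sub)).
  exact: (cvg_comp _ _ (cT t x t_ge0) (cq (T t x))).
have M0 : 0 <= M by rewrite le_max lexx.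
have [c _ cP] := EVT_max M0 contf.
exists (Num.max 1 (q (rescaled w T c x))) => t t_ge0; rewrite le_max.
have [tM|Mt] := leP t M; first by rewrite cP ?orbT// in_itv/= t_ge0.
by rewrite ltW// t0P// (le_lt_trans _ Mt)// le_max lexx orbT.
Qed.

(** The suprema lie in [[0, +oo]] and are eventually at most 1, hence finite, so the limit can be
    computed in the reals. *)
Lemma sup_on_cvg0P q A (S : R -> X -> X) : (forall x, 0 <= q x) ->
  sup_on q A (S t) @[t --> +oo] --> 0%E <->
  forall e, 0 < e -> \forall t \near +oo, forall x, A x -> q (S t x) <= e.
Proof.
move=> q0.
have sup_ge0 t : (0 <= sup_on q A (S t))%E by apply: ereal_sup_ubound; left.
have supP t e : 0 < e ->
    ((sup_on q A (S t) <= e%:E)%E <-> forall x, A x -> q (S t x) <= e).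
  move=> e0; split=> [supe x Ax|le_e].
    rewrite -lee_fin; apply: le_trans supe; apply: ereal_sup_ubound.
    by right; exists x.
  apply: ge_ereal_sup => _ [->|[x Ax <-]]; rewrite lee_fin; first exact: ltW.
  exact: le_e.
split=> [sup0 e e0|near_e].
  have : \forall t \near +oo, (sup_on q A (S t) < e%:E)%E.
    by apply: (sup0 [set y | (y < e%:E)%E]); apply: open_ereal_lt'; rewrite lte_fin.
  by apply: filterS => t /ltW/supP; exact.
apply/fine_cvgP; split.
  apply: filterS (near_e 1 ltr01) => t /supP => /(_ ltr01) sup1.
  by rewrite ge0_fin_numE// (le_lt_trans sup1)// ltry.
apply/cvgr0Pnorm_le => e e0.
apply: filterS (near_e e e0) => t /supP => /(_ e0) supe.
rewrite ger0_norm ?fine_ge0// -lee_fin fineK//.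
by rewrite ge0_fin_numE// (le_lt_trans supe)// ltry.
Qed.

Lemma cvgr_expRNM w : 0 < w -> expR (- w * t) @[t --> +oo] --> (0 : R).
Proof.
move=> w0; have -> : (fun t => expR (- w * t)) = (fun t => expR (- t)) \o *%R w.
  by apply/funext => t /=; rewrite mulNr.
apply: cvg_comp (@cvgr_expR R).
apply/cvgryPge => M; exists (M / w); split; first exact: num_real.
by move=> t /ltW; rewrite ler_pdivrMr// mulrC.
Qed.

(** The factor of rate [w / 2] is that of rate [w] times [expR (- (w / 2) * t)], which turns a
    uniform bound into decay. *)
Lemma sup_on_halved_rate q A w C : seminorm q -> 0 < w ->
  (forall t x, 0 <= t -> A x -> q (rescaled w T t x) <= C) ->
  sup_on q A (rescaled (w / 2) T t) @[t --> +oo] --> 0%E.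
Proof.
move=> sq w0 leC; apply/sup_on_cvg0P => [|e e0]; first by case: sq.
have : (`|C| * expR (- (w / 2) * t)) @[t --> +oo] --> (`|C| * 0 : R).
  by apply: cvgM; [exact: cvg_cst|apply: cvgr_expRNM; rewrite divr_gt0].
rewrite mulr0 => /cvgr_lt/(_ e e0) near_e.
near=> t => x Ax.
have t0 : 0 <= t by near: t; exact: nbhs_pinfty_ge.
apply: (@le_trans _ _ (`|C| * expR (- (w / 2) * t))); last by apply: ltW; near: t.
rewrite (@rescaled_split q (w / 2) w)// mulrC.
have -> : w / 2 - w = - (w / 2) by rewrite {2}[w]splitr opprD addrA subrr sub0r.
by rewrite ler_wpM2r ?expR_ge0// (le_trans (leC _ _ t0 Ax))// ler_norm.
Unshelve. all: by end_near. Qed.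

End semigroup_orbits.

(** * Baire-type covering arguments *)

Section covering.
Context {R : realType} {k : scalar_kind} {X : tvsType (scalar_field R k)}.
Local Notation "r %:K" := (@of_real R k r) (at level 2, format "r %:K").
Implicit Types (r s e : R) (x y z u : X) (n m : nat).

(* The form of Baire's theorem that the resonance argument needs. The family UU
   is the neighbourhood filter of 0 in a Baire space, and the family of positive
   multiples of a given bounded set in a Mackey complete space. *)
Definition nonmeager_along (UU : set (set X)) :=
  forall A : nat -> nat -> set X, (forall n m, closed (A n m)) ->
    (forall x, exists n m, A n m x) ->
    exists n m x, exists2 U, UU U & forall u, U u -> A n m (x + u) /\ A n m (x - u).

(** Makes the doubly indexed cover a sequence; an index that codes no pair contributes the empty
    set. *)
Let flatten (A : nat -> nat -> set X) (j : nat) : set X :=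
  if pickle_inv j is Some p then A p.1 p.2 else set0.

Let flattenE A n m : flatten A (pickle (n, m)) = A n m.
Proof. by rewrite /flatten pickleK_inv. Qed.

Lemma baire_nonmeager_along : baire_space X -> nonmeager_along (nbhs 0).
Proof.
move=> baireX A Acl Acov.
have [j intj] : exists j, interior (closure (flatten A j)) !=set0.
  apply: contra_notP baireX => /forallNP nd; exists (flatten A); split.
    by move=> j; apply: contrapT => /eqP/set0P; exact: nd.
  rewrite -subTset => x _; have [n [m Ax]] := Acov x.
  by exists (pickle (n, m)) => //; rewrite flattenE.
move: intj; rewrite /flatten; case: pickle_inv => [[n m]|] /=; last first.
  by rewrite closure0 interior0 => -[].
rewrite -(closure_id _).1// => -[x Ax]; exists n, m, x.
(* The translate of [A n m] by [- x] is a neighbourhood of 0, and so is its intersection with its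
   negative. *)
exists [set u | A n m (x + u) /\ A n m (x - u)] => //.
have U0 := nbhs0_translate Ax.
have := nbhs0N U0; move: U0; apply: filterS2 => u /= Au [v Av vu]; split=> //.
by rewrite -vu opprK.
Qed.

Context {Gamma : set (X -> R)} (fundamentalGamma : fundamental_system Gamma).

(* For r >= 0 this is r times the closed absolutely convex hull of B, by the
   bipolar theorem. *)
Definition disk (B : set X) r : set X :=
  [set x | forall q, Gamma q -> forall M, 0 <= M -> (forall y, B y -> q y <= M) ->
     q x <= r * M].

(** * Algebra and topology of the disks of a bounded set *)

Section disk_theory.
Context {B : set X} (B_bounded : vN_bounded B).

Lemma sub_disk1 : B `<=` disk B 1.
Proof. by move=> x Bx q _ M _ BM; rewrite mul1r BM. Qed.

Lemma disk_le r s : r <= s -> disk B r `<=` disk B s.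
Proof.
by move=> rs x Dx q Gq M M0 BM; rewrite (le_trans (Dx q Gq M M0 BM))// ler_wpM2r.
Qed.

Lemma diskD r s x y : disk B r x -> disk B s y -> disk B (r + s) (x + y).
Proof.
move=> Dx Dy q Gq M M0 BM; rewrite mulrDl.
have [_ qD _] := fundamental_seminorm fundamentalGamma Gq.
by rewrite (le_trans (qD _ _))// lerD// ?Dx ?Dy.
Qed.

Lemma diskN r x : disk B r x -> disk B r (- x).
Proof.
move=> Dx q Gq M M0 BM.
by rewrite (seminormN x (fundamental_seminorm fundamentalGamma Gq)) Dx.
Qed.

Lemma disk0 : disk B 0 0.
Proof.
move=> q Gq M _ _.
by rewrite (seminorm0 (fundamental_seminorm fundamentalGamma Gq)) mul0r.
Qed.

Lemma diskZ r s x : 0 <= s -> disk B r x -> disk B (s * r) (s%:K *: x).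
Proof.
move=> s0 Dx q Gq M M0 BM; rewrite -mulrA.
rewrite (seminormZr _ (fundamental_seminorm fundamentalGamma Gq))// ler_wpM2l//.
exact: Dx.
Qed.

Lemma disk_bound q : Gamma q ->
  exists2 M, 0 < M & forall r x, disk B r x -> q x <= r * M.
Proof.
move=> Gq.
have [M BM] := (vN_boundedP fundamentalGamma B).1 B_bounded q Gq.
have M0 : 0 < `|M| + 1 by rewrite ltr_wpDl.
exists (`|M| + 1) => // r x; apply; rewrite ?(ltW M0)// => y /BM /le_trans; apply.
by rewrite (le_trans (ler_norm M))// lerDl.
Qed.

Lemma disk_bounded r : vN_bounded (disk B r).
Proof.
apply/(vN_boundedP fundamentalGamma) => q /disk_bound[M _ DM].
by exists (r * M) => x; exact: DM.
Qed.

(** Boundedness of [B] lets the complement of a closed set leave room for a disk around each of its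
    points. *)
Lemma disk_small (U : set X) : nbhs 0 U -> exists2 e, 0 < e & disk B e `<=` U.
Proof.
move=> /(fundamental_nbhs0 fundamentalGamma)[q Gq [d d0 qU]].
have [M M0 DM] := disk_bound Gq.
exists (d / 2 / M); first by rewrite !divr_gt0.
move=> x /DM; rewrite mulfVK ?gt_eqF// => qx; apply: qU; apply: le_lt_trans qx _.
by rewrite gtr_pMr// invf_lt1// ltr1n.
Qed.

(** A disk is an intersection of closed seminorm balls, so membership survives limits. *)
Lemma disk_limit (u : nat -> X) (l z : X) r :
  u @ \oo --> l -> (\forall n \near \oo, disk B r (u n - z)) -> disk B r (l - z).
Proof.
move=> ul Du q Gq M M0 BM; apply/ler_addgt0Pr => e e0.
have sq := fundamental_seminorm fundamentalGamma Gq.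
have ulq : \forall n \near \oo, q (u n - l) < e.
  apply: (ul [set y | q (y - l) < e]); apply: (nbhs_translate l (U := [set x | q x < e])).
  exact: nbhs0_seminorm_lt (fundamental_continuous fundamentalGamma Gq) e0.
have [n [Dn qn]] := filter_ex (filterI Du ulq).
have -> : l - z = (u n - z) - (u n - l) by rewrite opprB [RHS]addrC addrA subrK.
by rewrite (le_trans (seminormB _ _ sq))// lerD// ?(ltW qn)// Dn.
Qed.

End disk_theory.

Lemma mackey_limit (B : set X) (u : nat -> X) (e : nat -> R) :
  mackey_complete X -> vN_bounded B ->
  (forall n, 0 < e n <= n.+1%:R^-1) ->
  (forall n m, (n <= m)%N -> disk B (e n) (u m - u n)) ->
  exists l : X, u @ \oo --> l.
Proof.
move=> completeX Bb e_small u_cauchy; apply: completeX.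
exists (disk B 1); split; first exact: disk_bounded.
(* The difference of two terms lies in the disk belonging to the earlier index, whose radius is at
   most this number. *)
pose b n m : R := (minn n m).+1%:R^-1.
exists (fun n m => (b n m)%:K); split.
  apply/cvgr0Pnorm_lt => _/of_real_gt0P[d d0 ->].
  have small : \forall n \near \oo, n.+1%:R^-1 < d.
    by move: (@cvg_harmonic R) => /cvgr_lt/(_ d d0).
  exists ([set n | n.+1%:R^-1 < d], [set n | n.+1%:R^-1 < d]) => //=.
  move=> [n m] /= [nd md]; rewrite -modulusE modulus_of_real ?invr_ge0// ltr_of_real.
  by rewrite /b; case: (leqP n m).
move=> n m; exists ((b n m)^-1%:K *: (u n - u m)); last first.
  by rewrite scalerA -of_realM divff ?invr_eq0// of_real1 scale1r.
have b0 : 0 < b n m by rewrite invr_gt0.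
rewrite -(mulVf (lt0r_neq0 b0)).
apply: diskZ; first by rewrite invr_ge0 ltW.
rewrite /b; have [nm|/ltnW mn] := leqP n m.
  rewrite -opprB; apply: diskN.
  by apply: disk_le (u_cauchy n m nm); case/andP: (e_small n).
by apply: disk_le (u_cauchy m n mn); case/andP: (e_small m).
Qed.

(* Baire's argument run with the shrinking "balls" u j + disk B (e j). *)
Lemma mackey_nonmeager_along (B : set X) : mackey_complete X -> vN_bounded B ->
  nonmeager_along [set U | exists2 e, 0 < e & U = disk B e].
Proof.
move=> completeX Bb A Acl Acov; apply: contrapT => meager.
(* One refinement: the new ball lies in the old one and avoids the set of index [j]. Positivity of
   the old radius stands under the existential so that [choice] yields a total function; [(0, 0)] is
   the dummy value. *)
have step (jxe : nat * (X * R)) : exists ye : X * R, 0 < jxe.2.2 ->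
    [/\ 0 < ye.2, ye.2 <= jxe.1.+2%:R^-1,
      disk B (jxe.2.2 - ye.2) (ye.1 - jxe.2.1) &
      forall z, disk B ye.2 (z - ye.1) -> ~ flatten A jxe.1 z].
  case: jxe => j [x e] /=.
  have [e0|] := ltP 0 e; last by exists (0, 0).
  have e20 : 0 < e / 2 by rewrite divr_gt0.
  (* Otherwise, disks being symmetric, [flatten A j] contains [x + u] and [x - u] for all [u] in the
     half disk, which [meager] excludes. *)
  have [v Dv Av] : exists2 v, disk B (e / 2) v & ~ flatten A j (x + v).
    apply: contrapT => /forall2NP allA; apply: meager.
    move: allA; rewrite /flatten; case: pickle_inv => [[n m]|] /= allA; last first.
      have [|] := allA 0; last by move=> /contrapT.
      by case; apply: disk_le disk0; exact: ltW.
    exists n, m, x, (disk B (e / 2)); first by exists (e / 2).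
    move=> u Du; split.
      by have [|/contrapT] := allA u.
    by have [|/contrapT//] := allA (- u); case; exact: diskN.
  have clj : closed (flatten A j).
    by rewrite /flatten; case: pickle_inv => [?|]; [exact: Acl|exact: closed0].
  have [d d0 Dd] : exists2 d, 0 < d & forall u, disk B d u -> ~ flatten A j (x + v + u).
    have : nbhs (x + v) (~` flatten A j).
      by apply: open_nbhs_nbhs; split => //; exact: closed_openC.
    by move=> /nbhs0_translate/(disk_small Bb).
  (* The bound [d] keeps the ball off the set, [e / 2] keeps it inside the old ball, and the last
     bound drives the radii to 0. *)
  pose e' := Num.min d (Num.min (e / 2) j.+2%:R^-1).
  have e'0 : 0 < e' by rewrite !lt_min d0 e20 invr_gt0 ltr0n.
  exists (x + v, e') => _ /=; split=> //.
  - by rewrite !ge_min lexx !orbT.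
  - rewrite addrAC subrr add0r; apply: disk_le Dv.
    by rewrite lerBrDr {2}[e]splitr lerD2l !ge_min lexx orbT.
  - move=> z Dz; rewrite -(subrK (x + v) z) addrC; apply: Dd.
    by apply: disk_le Dz; rewrite ge_min lexx.
have [f fP] := choice step.
pose ue := fix ue j : X * R := if j is i.+1 then f (i, ue i) else (0, 1).
pose u j := (ue j).1; pose e j := (ue j).2.
have e0 j : 0 < e j by elim: j => [|j /(fP (j, ue j))[]].
have ueP j := fP (j, ue j) (e0 j).
have e_small j : 0 < e j <= j.+1%:R^-1.
  by rewrite e0; case: j => [|j]; [rewrite invr1 lexx|case: (ueP j)].
(* Nesting of consecutive balls is recorded by differences of radii, which add up. *)
have telescope n m : disk B (e n - e (n + m)%N) (u (n + m)%N - u n).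
  elim: m => [|m IHm]; first by rewrite addn0 !subrr; exact: disk0.
  rewrite addnS -(subrK (u (n + m)%N) (u _)) -addrA.
  rewrite -(subrK (e (n + m)%N) (e n)) -addrA addrC.
  by apply: diskD IHm; rewrite ?[_ + (_ - _)]addrC; case: (ueP (n + m)%N).
have u_cauchy n m : (n <= m)%N -> disk B (e n) (u m - u n).
  move=> /subnKC <-; apply: disk_le (telescope n (m - n)%N).
  by rewrite gerBl ltW.
have [l ul] := mackey_limit completeX Bb e_small u_cauchy.
(* The limit lies in some [A n m] but also in every ball, and the ball of index one above the code
   of [(n, m)] avoids that set. *)
have [n [m Al]] := Acov l.
have [_ _ _ /(_ l)] := ueP (pickle (n, m)); rewrite flattenE; apply=> //.
by apply: (disk_limit ul); exists (pickle (n, m)).+1 => // i; exact: u_cauchy.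
Qed.

End covering.

(** * Uniform orbit bounds and exponential decay *)

Section exponential_stability.
Context {R : realType} {k : scalar_kind} {X : tvsType (scalar_field R k)}.
Context {Gamma : set (X -> R)} (fundamentalGamma : fundamental_system Gamma).
Context {T : R -> X -> X} (semigroupT : C0_semigroup T).
Local Notation "r %:K" := (@of_real R k r) (at level 2, format "r %:K").
Implicit Types (w t C : R) (x : X) (q : X -> R).

Lemma closed_orbit_le q w C : continuous_seminorm q ->
  closed [set x : X | forall t, 0 <= t -> q (rescaled w T t x) <= C].
Proof.
move=> cq; have -> : [set x : X | forall t, 0 <= t -> q (rescaled w T t x) <= C] =
    \bigcap_(t in [set t | 0 <= t]) [set x | q (rescaled w T t x) <= C].
  by apply/seteqP; split=> x.
apply: closed_bigI => t /= t0.
have [_ ct] := continuous_seminorm_rescaled semigroupT w cq t0.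
by apply: (closed_comp _ (@closed_le R C)) => x _; exact: ct.
Qed.

(** As a common unit ball of continuous seminorms the set is closed and absolutely convex;
    boundedness of each orbit makes it absorbing. *)
Lemma nbhs0_orbit_le1 q w : barrelled X -> Gamma q ->
  (forall x, rescaled w T t x @[t --> +oo] --> (0 : X)) ->
  nbhs 0 [set x : X | forall t, 0 <= t -> q (rescaled w T t x) <= 1].
Proof.
move=> barrelledX Gq T0; have cq := fundamental_continuous fundamentalGamma Gq.
have sqt t (t0 : 0 <= t) := (continuous_seminorm_rescaled semigroupT w cq t0).1.
apply: barrelledX; last exact: closed_orbit_le.
  by apply: (@absolutely_convex_seminorm_le R k X R [set t | 0 <= t]) => t; exact: sqt.
move=> x; have [C leC] := bounded_orbit fundamentalGamma semigroupT Gq (T0 x).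
have C0 : 0 < `|C| + 1 by rewrite ltr_wpDl.
exists (`|C| + 1)%:K; first by rewrite -(of_real0 (k := k)) ltr_of_real.
move=> a; rewrite -modulusE ler_of_real => Ca _ ->.
have a0 : a != 0 by rewrite -modulus_gt0 (lt_le_trans C0).
exists (a^-1 *: x); last by rewrite scalerA divff// scale1r.
move=> t t0; rewrite -(ler_pM2l (lt_le_trans C0 Ca)) -(seminormZ _ _ (sqt t t0)).
rewrite scalerA divff// scale1r mulr1 (le_trans _ Ca)// (le_trans (leC t t0))//.
by rewrite (le_trans (ler_norm C))// lerDl.
Qed.

(** If no exponent served, each rate [1 / (n + 1)] would have a seminorm unbounded along the orbits
    from every member of [UU]; the cover built from these seminorms refutes one of the choices. *)
Lemma common_exponent (UU : set (set X)) :
  nonmeager_along UU -> strongly_exp_stable T ->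
  exists2 w, 0 < w & forall q, Gamma q -> exists2 U, UU U &
    exists C, forall t x, 0 <= t -> U x -> q (rescaled w T t x) <= C.
Proof.
move=> nonmeager stableT; apply: contrapT => /forall2NP no_exponent.
pose w n : R := n.+1%:R^-1.
have w0 n : 0 < w n by rewrite invr_gt0.
have /choice[q qP] n : exists q, Gamma q /\ forall U, UU U ->
      ~ exists C, forall t x, 0 <= t -> U x -> q (rescaled (w n) T t x) <= C.
  have [//|] := no_exponent (w n).
  move=> /existsNP[p /not_implyP[Gp /forall2NP nU]]; exists p; split=> // U UUU.
  by have [] := nU U.
have cq n := fundamental_continuous fundamentalGamma (qP n).1.
pose A n m : set X := [set x | forall t, 0 <= t -> q n (rescaled (w n) T t x) <= m%:R].
have [n m|x|n [m [x [U UUU AU]]]] := nonmeager A.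
- exact: closed_orbit_le.
- have [w' w'0 Tx] := stableT x.
  (* The rate [w'] depends on [x], but a slower rate inherits its orbit bound. *)
  have [n nw'] : exists n, w n <= w'.
    have w'V0 : 0 <= w'^-1 by rewrite invr_ge0 ltW.
    exists (Num.bound w'^-1); rewrite /w invf_ple ?posrE ?ltr0n//.
    by rewrite (le_trans (ltW (archi_boundP w'V0)))// ler_nat.
  have [C leC] := bounded_orbit fundamentalGamma semigroupT (qP n).1 Tx.
  exists n, (Num.bound `|C|) => t t0.
  apply: (le_trans (le_seminorm_rescaled _ (cq n).1 nw' t0)).
  apply: (le_trans (leC t t0)); apply: (le_trans (ler_norm C)).
  by rewrite ltW// archi_boundP.
apply: ((qP n).2 U UUU); exists m%:R => t u t0 /AU[Axu Axu'].
have [sqt _] := continuous_seminorm_rescaled semigroupT (w n) (cq n) t0.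
(* Symmetry eliminates the unknown centre [x]: the bound [m] at both points passes to [u] without
   loss. *)
have eq2u : 2%:K *: u = (x + u) - (x - u).
  by rewrite opprB [RHS]addrC addrA subrK (_ : 2 = 1 + 1)//
    of_realD of_real1 scalerDl scale1r.
rewrite -(@ler_pM2l R 2)// -(seminormZr _ sqt)// eq2u.
by rewrite (le_trans (seminormB _ _ sqt))// mulr_natl mulr2n lerD// ?Axu ?Axu'.
Qed.

Lemma uniform_decay q w (U : set X) C : Gamma q -> 0 < w -> nbhs 0 U ->
  (forall t x, 0 <= t -> U x -> q (rescaled w T t x) <= C) ->
  exists2 p, Gamma p &
    sup_on q [set x | p x <= 1] (rescaled (w / 2) T t) @[t --> +oo] --> 0%E.
Proof.
move=> Gq w0 /(fundamental_nbhs0 fundamentalGamma)[p Gp [d d0 pU]] UC.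
have cq := fundamental_continuous fundamentalGamma Gq.
have sp := fundamental_seminorm fundamentalGamma Gp.
(* Scaling by [d / 2] moves the unit ball of [p] into [U]; undoing it costs the factor [2 / d]. *)
exists p => //; apply: (@sup_on_halved_rate _ _ _ _ _ _ _ (2 / d * C)) => //.
  by case: cq.
move=> t x t0 /= px.
have [sqt _] := continuous_seminorm_rescaled semigroupT w cq t0.
have d20 : 0 < d / 2 by rewrite divr_gt0.
rewrite -invf_div ler_pdivlMl// -(seminormZr _ sqt) ?(ltW d20)//.
apply: UC => //; apply: pU; rewrite seminormZr ?(ltW d20)//.
apply: (@le_lt_trans _ _ (d / 2)); first by rewrite ler_piMr// ltW.
by rewrite gtr_pMr// invf_lt1// ltr1n.
Qed.

End exponential_stability.

Theorem theorem2p4 (R : realType) (k : scalar_kind) (X : tvsType (scalar_field R k))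
    (hausdorffX : hausdorff_space X)
    (Gamma : set (X -> R)) (fundamentalGamma : fundamental_system Gamma)
    (T : R -> X -> X) (semigroupT : C0_semigroup T) :
  let i := uniformly_exp_stable Gamma T in
  let ii := exists2 w : R, 0 < w &
    forall q, Gamma q -> exists2 p, Gamma p &
      sup_on q [set x | p x <= 1] (rescaled w T t) @[t --> +oo] --> 0%E in
  let iii := exists2 w : R, 0 < w &
    forall x : X, rescaled w T t x @[t --> +oo] --> (0 : X) in
  let iv := strongly_exp_stable T in
  let v := forall B : set X, vN_bounded B -> exists2 w : R, 0 < w &
    forall q, Gamma q -> sup_on q B (rescaled w T t) @[t --> +oo] --> 0%E in
  [/\ barrelled X -> [<-> i; ii; iii],
      mackey_complete X -> (iv <-> v) &
      baire_space X -> [<-> i; ii; iii; iv; v]].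
Proof.
move=> i ii iii iv v.
have q_ge0 q x : Gamma q -> 0 <= q x.
  by move=> /(fundamental_seminorm fundamentalGamma)[].
have pointwise w x : (forall q, Gamma q ->
      sup_on q [set x] (rescaled w T t) @[t --> +oo] --> 0%E) ->
    rescaled w T t x @[t --> +oo] --> (0 : X).
  move=> supw; apply/(fundamental_cvg0 fundamentalGamma) => q Gq e e0.
  (* The supremum yields only a weak inequality, so [e / 2] is used to reach a strict one. *)
  have /sup_on_cvg0P := supw q Gq.
  move=> /(_ (fun y => q_ge0 q y Gq) (e / 2)); rewrite divr_gt0// => /(_ isT).
  apply: filterS => t /(_ x erefl) /le_lt_trans; apply.
  by rewrite gtr_pMr// invf_lt1// ltr1n.
have ii_i : ii -> i.
  move=> [w w0 wP]; exists w => // B q Bb Gq.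
  have [p Gp supp] := wP q Gq.
  have [M BM] := (vN_boundedP fundamentalGamma B).1 Bb p Gp.
  have M0 : 0 < `|M| + 1 by rewrite ltr_wpDl.
  have sp := fundamental_seminorm fundamentalGamma Gp.
  apply/sup_on_cvg0P => [x|e e0]; first exact: q_ge0.
  (* The set [B] lies in the unit ball of [p] scaled by [|M| + 1], so decay is requested with this
     smaller tolerance. *)
  have e'0 : 0 < e / (`|M| + 1) by rewrite divr_gt0.
  move: supp => /(sup_on_cvg0P _ _ (fun y => q_ge0 q y Gq))/(_ _ e'0).
  apply: filterS2 (nbhs_pinfty_ge (num_real 0)) => t t0 supt x Bx.
  have cq := fundamental_continuous fundamentalGamma Gq.
  have [sqt _] := continuous_seminorm_rescaled semigroupT w cq t0.
  have px : p (of_real k (`|M| + 1)^-1 *: x) <= 1.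
    rewrite seminormZr ?invr_ge0 ?(ltW M0)// ler_pdivrMl// mulr1.
    by rewrite (le_trans (BM x Bx))// (le_trans (ler_norm M))// lerDl.
  have := supt _ px; rewrite (seminormZr _ sqt) ?invr_ge0 ?(ltW M0)//.
  by rewrite mulrC ler_pM2r ?invr_gt0.
have i_iii : i -> iii.
  move=> [w w0 wP]; exists w => // x; apply: pointwise => q.
  exact/wP/(vN_bounded1 fundamentalGamma).
have v_iv : v -> iv.
  move=> vT x; have [w w0 wP] := vT _ (vN_bounded1 fundamentalGamma x).
  by exists w => //; exact: pointwise.
have i_v : i -> v.
  by move=> [w w0 wP] B Bb; exists w => // q; exact: wP.
have iii_iv : iii -> iv by move=> [w w0 wP] x; exists w.
split.
- move=> barrelledX; have iii_ii : iii -> ii.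
    move=> [w w0 wP]; exists (w / 2); first by rewrite divr_gt0.
    move=> q Gq; have U0 := nbhs0_orbit_le1 fundamentalGamma semigroupT barrelledX Gq wP.
    by apply: (uniform_decay fundamentalGamma semigroupT Gq w0 U0) => t x t0; apply.
  tfae.
  + by move=> /i_iii/iii_ii.
  + by move=> /ii_i/i_iii.
  + by move=> /iii_ii/ii_i.
- move=> completeX; split=> // ivT B Bb.
  have [w w0 wP] := common_exponent fundamentalGamma semigroupT
    (mackey_nonmeager_along fundamentalGamma completeX Bb) ivT.
  exists (w / 2) => [|q Gq]; first by rewrite divr_gt0.
  have sq := fundamental_seminorm fundamentalGamma Gq.
  have [U [e e0 ->] [C DC]] := wP q Gq.
  (* The bound [C] holds on [disk B e], which contains [B] scaled by [e]. *)
  apply: (sup_on_halved_rate (C := e^-1 * C)) => // t x t0 Bx.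
  have cq := fundamental_continuous fundamentalGamma Gq.
  have [sqt _] := continuous_seminorm_rescaled semigroupT w cq t0.
  rewrite ler_pdivlMl// -(seminormZr _ sqt) ?(ltW e0)//; apply: DC => //.
  by have := diskZ fundamentalGamma (ltW e0) (sub_disk1 Bx); rewrite mulr1.
- move=> baireX; have iv_ii : iv -> ii.
    move=> ivT; have [w w0 wP] := common_exponent fundamentalGamma semigroupT
      (baire_nonmeager_along baireX) ivT.
    exists (w / 2) => [|q Gq]; first by rewrite divr_gt0.
    have [U U0 [C UC]] := wP q Gq.
    exact: (uniform_decay fundamentalGamma semigroupT Gq w0 U0 UC).
  tfae.
  + by move=> /i_iii/iii_iv/iv_ii.
  + by move=> /ii_i/i_iii.
  + by [].
  + by move=> /iv_ii/ii_i/i_v.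
  + by move=> /v_iv/iv_ii/ii_i.
Qed.
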